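(* Consider the security game of the context in which the attacker has a fixed total budget $\overline\Omega_a\ge0$: the defender chooses $\bm\pi_d\in\mathbb R^N$, $\bm\pi_d\ge\bm 0$, so as to minimize its total defense budget $\bm 1\cdot\bm\pi_d$ while keeping the minimal cost of a successful attack, $\min_{\bm\beta_{\text{attack}}}(\bm\kappa\circ\bm\pi_d)\cdot\bm\beta_{\text{attack}}$ (minimum over all successful attacks), at least $\overline\Omega_a$. Let $\bm\beta_{\text{attack},1},\dots,\bm\beta_{\text{attack},t_0}$ ($t_0\ge1$) be the list of all successful attacks with $\beta_{\text{attack}}^{(i)}=0$ for all $i\in\mathcal V\setminus\mathcal V_{\text{pin}}$, and let $\mathcal M\in\mathbb R^{t_0\times N}$ be the matrix whose $i$-th row is $(\bm\kappa\circ\bm\beta_{\text{attack},i})'$ (corresponding to $\eta=0$). Then the optimal defender strategy $\bm\pi_d^\star$ is given by solving the linear program $$\min_{\bm\pi_d\in\mathbb R^N}\ \bm 1\cdot\bm\pi_d\quad\text{s.t.}\quad \mathcal M\bm\pi_d\ge\overline\Omega_a\bm 1,\quad \bm\pi_d\ge\bm 0.$$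
   Context: Data: $\mathcal V=\{1,\dots,N\}$; $\mathcal A=[a_{ij}]\in\mathbb R^{N\times N}$ is the coupling matrix of a connected undirected graph on $\mathcal V$ ($a_{ij}=a_{ji}=1$ if $i\neq j$ are adjacent, $0$ if $i\neq j$ are not adjacent, $a_{ii}=-\sum_{j\ne i}a_{ij}$); $c>0$ is the coupling strength, $\bar c>0$ the identical control gain, $a_g>0$; $J[\bm f(\bar{\bm x})]\in\mathbb R^{n\times n}$ is symmetric with largest eigenvalue $\lambda_n(J[\bm f(\bar{\bm x})])$; $\lambda_{\max}$ is the largest eigenvalue of a symmetric matrix; $\circ$ is the entrywise product; $\bm 1$ is the all-ones vector; vector inequalities are entrywise. $\mathcal V_{\text{pin}}\subseteq\mathcal V$ is a given set of pinned nodes with indicator vector $\bm\beta_{\text{pin}}\in\{0,1\}^N$, such that the network without attack is synchronized: $\lambda_{\max}(\mathcal A-(\bar c/c)\,\mathrm{diag}\{\bm\beta_{\text{pin}}\})\le-\lambda_n(J[\bm f(\bar{\bm x})])/(c\,a_g)$. $\bm\kappa=[\kappa^{(1)},\dots,\kappa^{(N)}]'$ has positive entries. $\pi_d^{(i)}$ is the defense budget allocated to node $i$. A successful attack is a vector $\bm\beta_{\text{attack}}\in\{0,1\}^N$ (with $\beta_{\text{attack}}^{(i)}=1$ meaning node $i$ is compromised) satisfying $$\lambda_{\max}\Big(\mathcal A-\frac{\bar c}{c}\,\mathrm{diag}\{\bm\beta_{\text{pin}}\circ(\bm 1-\bm\beta_{\text{attack}})\}\Big)\ge-\frac{\lambda_n(J[\bm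 f(\bar{\bm x})])}{c\,a_g},$$ and its cost to the attacker is $(\bm\kappa\circ\bm\pi_d)\cdot\bm\beta_{\text{attack}}$. *)

(* Defs.v *)
From HB Require Import structures.
From mathcomp Require Import all_boot all_order all_algebra.
From mathcomp Require Import classical_sets reals.

Set Implicit Arguments.
Unset Strict Implicit.
Unset Printing Implicit Defensive.

Import Order.TTheory GRing.Theory Num.Theory.
Local Open Scope ring_scope.

Definition minimizes (R : realType) (T : Type) (F : T -> Prop) (f : T -> R)
    (x : T) : Prop :=
  F x /\ forall y, F y -> f x <= f y.

(* Meant for symmetric matrices of positive size: their set of real
   eigenvalues is finite and nonempty, so that [sup] is a maximum. *)
Definition lambda_max (R : realType) (n : nat) (A : 'M[R]_n) : R :=
  sup [set a : R | eigenvalue A a]%classic.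

Definition hadamard (R : realType) (m n : nat) (A B : 'M[R]_(m, n)) :
  'M[R]_(m, n) := map2_mx *%R A B.

Definition dot (R : realType) (n : nat) (u v : 'cV[R]_n) : R :=
  \sum_(i < n) u i 0 * v i 0.

Definition vec_le (R : realType) (n : nat) (u v : 'cV[R]_n) : Prop :=
  forall i, u i 0 <= v i 0.

(* The sign is the paper's: this is minus the graph Laplacian. *)
Definition coupling_mx (R : realType) (N : nat) (adj : rel 'I_N) : 'M[R]_N :=
  \matrix_(i, j)
    (if i == j then - \sum_(k < N | k != i) (adj i k)%:R else (adj i j)%:R).

Definition indicator_vec (R : realType) (N : nat) (V : {set 'I_N}) :
  'cV[R]_N := \col_i (i \in V)%:R.

(* Attack vectors in {0,1}^N are Boolean columns, so that they form a finType;
   this is their image in R^N. *)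
Definition attack_vec (R : realType) (N : nat) (b : 'cV[bool]_N) : 'cV[R]_N :=
  \col_i (b i 0)%:R.

Definition controlled_lambda (R : realType) (N : nat) (A : 'M[R]_N)
    (c cbar : R) (beta : 'cV[R]_N) : R :=
  lambda_max (A - (cbar / c) *: diag_mx beta^T).

Definition sync_threshold (R : realType) (n : nat) (J : 'M[R]_n) (c ag : R) :
  R := - (lambda_max J / (c * ag)).

Definition successful_attack (R : realType) (N n : nat) (A : 'M[R]_N)
    (c cbar ag : R) (J : 'M[R]_n) (beta_pin : 'cV[R]_N) (b : 'cV[bool]_N) :
    bool :=
  sync_threshold J c ag <=
    controlled_lambda A c cbar
      (hadamard beta_pin (const_mx 1 - attack_vec R b)).

Definition attack_cost (R : realType) (N : nat) (kappa pi_d : 'cV[R]_N)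
    (b : 'cV[bool]_N) : R :=
  dot (hadamard kappa pi_d) (attack_vec R b).

Definition total_budget (R : realType) (N : nat) (pi_d : 'cV[R]_N) : R :=
  dot (const_mx 1) pi_d.

Definition defender_feasible (R : realType) (N : nat)
    (succ : 'cV[bool]_N -> bool) (kappa : 'cV[R]_N) (Omega_a : R)
    (pi_d : 'cV[R]_N) : Prop :=
  vec_le 0 pi_d /\
  exists b, minimizes succ (attack_cost kappa pi_d) b /\
            Omega_a <= attack_cost kappa pi_d b.

Definition attack_mx (R : realType) (N t0 : nat) (kappa : 'cV[R]_N)
    (betas : t0.-tuple 'cV[bool]_N) : 'M[R]_(t0, N) :=
  \matrix_(i < t0) (hadamard kappa (attack_vec R (tnth betas i)))^T.

Definition lp_feasible (R : realType) (N t0 : nat) (M : 'M[R]_(t0, N))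
    (Omega_a : R) (pi_d : 'cV[R]_N) : Prop :=
  vec_le (Omega_a *: const_mx 1) (M *m pi_d) /\ vec_le 0 pi_d.

(* Main.v *)
(* Only the entries of an attack on pinned nodes enter the success condition, so
   switching off the other entries keeps an attack successful and, budgets being
   nonnegative, does not raise its cost. Hence bounding the cost of the cheapest
   successful attack amounts to bounding the costs of the successful attacks
   supported on the pinned nodes: the two problems have the same feasible set. *)
Require Import Defs.
From HB Require Import structures.
From mathcomp Require Import all_boot all_order all_algebra.
From mathcomp Require Import classical_sets reals.

Import Order.TTheory GRing.Theory Num.Theory.
Local Open Scope ring_scope.

Definition restrict_attack {N : nat} (V : {set 'I_N}) (b : 'cV[bool]_N) :
  'cV[bool]_N := \col_i (b i 0 && (i \in V)).

Lemma eq_minimizes (R : realType) (T : Type) (F G : T -> Prop) (f : T -> R)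
    (x : T) :
  (forall y, F y <-> G y) -> minimizes F f x <-> minimizes G f x.
Proof.
by move=> FG; split=> -[/FG Fx xmin]; split=> // y /FG; exact: xmin.
Qed.

(** The two control vectors agree entrywise: on [V] the restriction leaves [b] unchanged, and off
    [V] the indicator makes both entries zero. *)
Lemma successful_restrict_attack (R : realType) (N n : nat) (A : 'M[R]_N)
    (c cbar ag : R) (J : 'M[R]_n) (V : {set 'I_N}) (b : 'cV[bool]_N) :
  successful_attack A c cbar ag J (indicator_vec R V) (restrict_attack V b) =
  successful_attack A c cbar ag J (indicator_vec R V) b.
Proof.
rewrite /successful_attack; congr (_ <= controlled_lambda _ _ _ _).
apply/colP => i; rewrite !mxE.
by case: (i \in V); rewrite ?andbT // !mul0r.
Qed.

(** Termwise: each weight [kappa i 0 * pi_d i 0] is nonnegative, and restricting can only turn a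
    factor 1 into 0. *)
Lemma attack_cost_restrict (R : realType) (N : nat) (kappa pi_d : 'cV[R]_N)
    (V : {set 'I_N}) (b : 'cV[bool]_N) :
  vec_le 0 kappa -> vec_le 0 pi_d ->
  attack_cost kappa pi_d (restrict_attack V b) <= attack_cost kappa pi_d b.
Proof.
move=> kappa_ge0 pi_ge0; apply: ler_sum => i _; rewrite !mxE.
have := kappa_ge0 i; have := pi_ge0 i; rewrite !mxE => pi_i kappa_i.
apply: ler_wpM2l; first exact: mulr_ge0.
by rewrite ler_nat; case: (b i 0); case: (i \in V).
Qed.

Lemma attack_mx_mulE (R : realType) (N t : nat) (kappa pi_d : 'cV[R]_N)
    (betas : t.-tuple 'cV[bool]_N) (i : 'I_t) :
  (attack_mx kappa betas *m pi_d) i 0 =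
  attack_cost kappa pi_d (tnth betas i).
Proof.
by rewrite mxE; apply: eq_bigr => j _; rewrite !mxE mulrAC.
Qed.

(** Brings the linear constraints to the same shape as [defender_feasibleE], so that only the two
    families of attacks remain to be compared. *)
Lemma lp_feasibleE (R : realType) (N t : nat) (kappa pi_d : 'cV[R]_N)
    (betas : t.-tuple 'cV[bool]_N) (Omega_a : R) :
  lp_feasible (attack_mx kappa betas) Omega_a pi_d <->
  (forall b, b \in betas -> Omega_a <= attack_cost kappa pi_d b) /\
  vec_le 0 pi_d.
Proof.
split=> -[cost_ge pi_ge0]; split=> //.
  move=> b /tnthP[i ->].
  by have := cost_ge i; rewrite attack_mx_mulE !mxE mulr1.
by move=> i; rewrite attack_mx_mulE !mxE mulr1; apply/cost_ge/mem_tnth.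
Qed.

Lemma defender_feasibleE (R : realType) (N : nat) (succ : 'cV[bool]_N -> bool)
    (kappa pi_d : 'cV[R]_N) (Omega_a : R) (b0 : 'cV[bool]_N) :
  succ b0 ->
  defender_feasible succ kappa Omega_a pi_d <->
  (forall b, succ b -> Omega_a <= attack_cost kappa pi_d b) /\ vec_le 0 pi_d.
Proof.
move=> succ0; split=> [[pi_ge0 [b [[_ bmin] le_b]]]|[cost_ge pi_ge0]].
  by split=> // b' /bmin; exact: le_trans.
split=> //.
(* Boolean columns form a finite type and [b0] is successful, so a cheapest successful attack
   exists. *)
case: (arg_minP (attack_cost kappa pi_d) succ0) => b succ_b bmin.
by exists b; split; [split | exact: cost_ge].
Qed.

Theorem proposition4p3 (R : realType) (N n : nat) (N_gt0 : (0 < N)%N)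
  (n_gt0 : (0 < n)%N)
  (adj : rel 'I_N) (adj_sym : symmetric adj) (adj_irr : irreflexive adj)
  (adj_conn : forall x y : 'I_N, connect adj x y)
  (c cbar ag : R) (c_gt0 : 0 < c) (cbar_gt0 : 0 < cbar) (ag_gt0 : 0 < ag)
  (J : 'M[R]_n) (J_sym : J^T = J)
  (Vpin : {set 'I_N})
  (sync : controlled_lambda (coupling_mx R adj) c cbar (indicator_vec R Vpin)
            <= sync_threshold J c ag)
  (kappa : 'cV[R]_N) (kappa_gt0 : forall i, 0 < kappa i 0)
  (Omega_a : R) (Omega_a_ge0 : 0 <= Omega_a)
  (t0 : nat) (t0_gt0 : (0 < t0)%N)
  (betas : t0.-tuple 'cV[bool]_N) (betas_uniq : uniq betas)
  (betasP : forall b : 'cV[bool]_N,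
     b \in betas <->
     successful_attack (coupling_mx R adj) c cbar ag J
       (indicator_vec R Vpin) b /\
     (forall i, i \notin Vpin -> b i 0 = false))
  (pi_d : 'cV[R]_N) :
  minimizes
    (defender_feasible
       (successful_attack (coupling_mx R adj) c cbar ag J
          (indicator_vec R Vpin))
       kappa Omega_a)
    (@total_budget R N) pi_d
  <->
  minimizes (lp_feasible (attack_mx kappa betas) Omega_a)
    (@total_budget R N) pi_d.
Proof.
apply: eq_minimizes => pi.
(* As [t0] is positive, the first listed attack shows that the attacker's minimum ranges over a
   nonempty set. *)
have [succ0 _] := (betasP _).1 (mem_tnth (Ordinal t0_gt0) betas).
rewrite (defender_feasibleE _ _ _ _ _ _ _ succ0) lp_feasibleE.
split=> -[cost_ge pi_ge0]; split=> // b; first by move=> /betasP[/cost_ge].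
move=> succ_b.
(* The restriction of [b] to [Vpin] is a listed attack, so a row of the linear program bounds its
   cost, which is at most that of [b]. *)
apply: (@le_trans _ _ (attack_cost kappa pi (restrict_attack Vpin b))).
  apply/cost_ge/betasP; split; first by rewrite successful_restrict_attack.
  by move=> i /negbTE iV; rewrite mxE iV andbF.
by apply: attack_cost_restrict => // i; rewrite mxE ltW.
Qed.
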